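(* For every positive integers $c$ and $m$ there is a finite point set $S\subset\mathbb{R}^4$ such that for every coloring of $S$ with $c$ colors there is a hextant that contains exactly $m$ points of $S$, all of the same color.
   Context: A (positive) hextant in $\mathbb{R}^4$ is a set of the form $\{(x,y,z,w)\in\mathbb{R}^4 : x\ge x_0,\ y\ge y_0,\ z\ge z_0,\ w\ge w_0\}$ for some real numbers $x_0,y_0,z_0,w_0$. *)

(* Defs.v *)
From mathcomp Require Import all_boot all_order all_algebra.
From mathcomp Require Import finmap.
From mathcomp Require Import reals.

Set Implicit Arguments.
Unset Strict Implicit.
Unset Printing Implicit Defensive.

Import Order.TTheory GRing.Theory Num.Theory.
Local Open Scope ring_scope.

(* Coordinates 0, 1, 2, 3 stand for x, y, z, w; the apex [a] is
   (x_0, y_0, z_0, w_0). *)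
Definition hextant (R : realType) (a : 'rV[R]_4) : {pred 'rV[R]_4} :=
  [pred p : 'rV[R]_4 | [forall i : 'I_4, a 0 i <= p 0 i]].

(* Main.v *)
Require Import Defs.
From mathcomp Require Import all_boot all_order all_algebra.
From mathcomp Require Import finmap reals.
From mathcomp Require Import zify.

(** A point of R^4 encodes a rectangle [l, r) x [p, q) and a hextant encodes a
    point (x, y) of the plane, so the theorem asks for finitely many rectangles
    such that every colouring has a point covered by exactly [m] of them, all of
    one colour.

    Consider first the game on a line in which Builder plays intervals one by
    one and Painter colours each of them at once; Builder wins when some point
    is covered by exactly [m] intervals, all of the same colour.  Builder can
    force, in any fresh segment, points [y_i], one for each colour [i], covered
    by exactly [k_i] intervals, all of colour [i], with [\sum_i k_i >= s].  To go
    from [s] to [s + 1], play in two adjacent fresh segments.  If the two vectors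
    [k] differ, their maximum has a larger sum.  Otherwise play an interval that
    covers the second segment only: if it gets colour [i], take [y_i] from the
    second segment and the other points from the first.  When
    [s > c (m - 1)], some [k_i] must have passed through [m].

    The [x]-axis turns the game tree into a static family: the rectangle of a
    move is the played interval times a cell, and the continuations after the
    [c] possible answers live in disjoint subcells. *)

Local Open Scope nat_scope.

(** * The interval game on a line *)

Definition covers (J : nat * nat) (y : nat) : bool := J.1 <= y < J.2.

(* The most recent move comes first. *)
Notation history c := (seq ((nat * nat) * 'I_c)).

Definition fresh {c} (y : nat) (h : history c) : bool :=
  all (fun e => ~~ covers e.1 y) h.

Definition pure {c} (y : nat) (i : 'I_c) (k : nat) (h : history c) : bool :=
  (count (fun e => covers e.1 y) h == k) &&
  all (fun e => covers e.1 y ==> (e.2 == i)) h.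

Definition won {c} (m : nat) (h : history c) : Prop :=
  exists y i, pure y i m h.

Inductive forces {c} (m : nat) (h : history c) : Prop :=
| forces_now : won m h -> forces m h
| forces_play J : (forall i, forces m ((J, i) :: h)) -> forces m h.

Lemma fresh_cat c y (t h : history c) :
  fresh y (t ++ h) = fresh y t && fresh y h.
Proof. exact: all_cat. Qed.

Lemma fresh_pure c y i (h : history c) : fresh y h -> pure y i 0 h.
Proof.
move=> /allP fh; rewrite /pure -leqn0 leqNgt -has_count; apply/andP; split.
  by apply/hasPn => e /fh.
by apply/allP => e /fh /negbTE ->.
Qed.

Lemma pure_cat_fresh c y i k (t h : history c) :
  fresh y t -> pure y i k (t ++ h) = pure y i k h.
Proof.
move=> /(@fresh_pure c y i) /andP[/eqP t0 mt].
by rewrite /pure count_cat all_cat t0 mt.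
Qed.

Lemma pure_cons_covers c y i k J (h : history c) :
  covers J y -> pure y i k.+1 ((J, i) :: h) = pure y i k h.
Proof. by move=> Jy; rewrite /pure /= Jy eqxx /= add1n eqSS. Qed.

Lemma pure_cons_avoids c y i j k J (h : history c) :
  ~~ covers J y -> pure y i k ((J, j) :: h) = pure y i k h.
Proof. by move=> /negbTE Jy; rewrite /pure /= Jy. Qed.

Definition config {c} (m s n w : nat) (h : history c) : Prop :=
  exists k : 'I_c -> nat,
    s <= \sum_i k i /\
    forall i, k i < m /\ exists y, (n <= y < n + w) && pure y i (k i) h.

Lemma sum_maxn_gt c (k1 k2 : 'I_c -> nat) s i :
  s <= \sum_j k1 j -> s <= \sum_j k2 j -> k1 i != k2 i ->
  s < \sum_j maxn (k1 j) (k2 j).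
Proof.
move=> s1 s2; rewrite neq_ltn => /orP[]lt12;
  [apply: leq_ltn_trans s1 _ | apply: leq_ltn_trans s2 _];
  rewrite (bigD1 i) //= [ltnRHS](bigD1 i) //= -addSn leq_add //;
  by [rewrite leq_max lt12 ?orbT | apply: leq_sum => j _; rewrite leq_max leqnn ?orbT].
Qed.

(* In continuation-passing form: the moves [t] forced inside a fresh segment
   cover nothing outside it, so they do not disturb the rest of the play. *)
Lemma forces_config c m s n (h : history c) : 0 < m ->
  (forall y, n <= y < n + 2 ^ s -> fresh y h) ->
  (forall t, (forall y, ~~ (n <= y < n + 2 ^ s) -> fresh y t) ->
     config m s n (2 ^ s) (t ++ h) -> forces m (t ++ h)) ->
  forces m h.
Proof.
move=> m0; elim: s n h => [|s IHs] n h fh cont.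
  apply: (cont [::]) => //; exists (fun=> 0); split=> // i; split=> //.
  by exists n; rewrite fresh_pure ?fh //=; lia.
have s2 : 2 ^ s.+1 = 2 ^ s + 2 ^ s by rewrite expnS; lia.
rewrite {}s2 in fh cont; set w := 2 ^ s in fh cont IHs.
apply: (IHs n) => [y yn|t1 ft1 [k1 [s1 k1P]]]; first by apply: fh; lia.
apply: (IHs (n + w)) => [y yn|t2 ft2 [k2 [s2 k2P]]].
  by rewrite fresh_cat ft1 ?fh //; lia.
have {k1P}k1P i : k1 i < m /\
    exists y, (n <= y < n + w) && pure y i (k1 i) (t2 ++ t1 ++ h).
  have [ltm [y /andP[yn py]]] := k1P i; split=> //; exists y.
  by rewrite yn pure_cat_fresh ?ft2 //; lia.
case: (pickP (fun i => k1 i != k2 i)) => [i ne|eq12].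
  rewrite catA; apply: cont => [y yn|].
    by rewrite fresh_cat ft1 ?ft2 //; lia.
  exists (fun j => maxn (k1 j) (k2 j)); split; first exact: (@sum_maxn_gt _ _ _ _ i).
  move=> j; have [lt1 [y1 /andP[yn1 p1]]] := k1P j.
  have [lt2 [y2 /andP[yn2 p2]]] := k2P j; split; first by rewrite gtn_max lt1.
  rewrite -catA; case: (leqP (k1 j) (k2 j)) => _.
    by exists y2; rewrite p2 andbT; lia.
  by exists y1; rewrite p1 andbT; lia.
have {}eq12 i : k1 i = k2 i by move: (eq12 i) => /negbFE /eqP.
apply: (@forces_play _ _ _ (n + w, n + (w + w))) => i; set J := (n + w, _).
have [_ [yi /andP[yin]]] := k2P i; rewrite -(@pure_cons_covers _ _ _ _ J); last first.
  by rewrite /covers /=; lia.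
rewrite -eq12 => pyi; have [lti _] := k1P i.
have := lti; rewrite leq_eqVlt => /orP[/eqP eqm|ltm].
  by apply: forces_now; exists yi, i; rewrite -eqm.
rewrite catA -cat_cons; apply: cont => [y yn|].
  rewrite /= fresh_cat ft1 ?ft2 ?andbT; try lia.
  by rewrite /covers /=; lia.
exists (fun j => k1 j + (j == i)); split.
  by rewrite big_split /= -addn1 leq_add // (bigD1 i) //= eqxx.
rewrite cat_cons -catA => j; case: eqVneq => [->|ne].
  by rewrite addn1; split=> //; exists yi; rewrite pyi andbT; lia.
rewrite addn0; have [ltj [y /andP[yn py]]] := k1P j; split=> //.
exists y; rewrite pure_cons_avoids ?py /covers /=; lia.
Qed.

Lemma forces_nil c m : 0 < m -> @forces c m [::].
Proof.
(* Multiplicities below [m] sum to at most [c * m.-1], so with this [s] the configuration is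
   impossible. *)
move=> m0; apply: (@forces_config c m (c * m.-1).+1 0) => // t _ [k [sk kP]].
suff : \sum_i k i <= c * m.-1 by lia.
rewrite -[X in X * _]card_ord -sum_nat_const.
by apply: leq_sum => i _; have [] := kP i; lia.
Qed.

(** * From the game to static rectangles *)

(* [(X, J)] stands for the rectangle X x J. *)
Notation rectangle := ((nat * nat) * (nat * nat))%type.

(* The moves, together with their colours, whose rectangles meet the vertical
   line at [x]. *)
Definition trace {c} (col : rectangle -> 'I_c) (x : nat) (s : seq rectangle) :
    history c :=
  [seq (r.2, col r) | r <- s & covers r.1 x].

Lemma won_perm c m (h h' : history c) : perm_eq h h' -> won m h -> won m h'.
Proof.
move=> hh' [y [i p]]; exists y, i; rewrite /pure in p *.
by rewrite -(permP hh') -(perm_all _ hh').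
Qed.

(** Nonemptiness of the interval keeps a rectangle from lying in two disjoint cells. *)
Definition in_cell (a w : nat) (r : rectangle) : bool :=
  [&& a <= r.1.1, r.1.1 < r.1.2 & r.1.2 <= a + w].

Lemma trace_outside c (col : rectangle -> 'I_c) x a w s :
  all (in_cell a w) s -> ~~ (a <= x < a + w) -> trace col x s = [::].
Proof.
move=> /allP sP xa; rewrite /trace (_ : filter _ _ = [::]) //.
apply/eqP; rewrite -[_ == _]negbK -has_filter; apply/hasPn => r /sP.
by rewrite /in_cell /covers; lia.
Qed.

Lemma trace_cat c (col : rectangle -> 'I_c) x s t :
  trace col x (s ++ t) = trace col x s ++ trace col x t.
Proof. by rewrite /trace filter_cat map_cat. Qed.

Lemma trace_flatten c (col : rectangle -> 'I_c) x (I : eqType) (F : I -> seq rectangle)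
    (i : I) (s : seq I) :
  uniq s -> i \in s -> (forall j, j != i -> trace col x (F j) = [::]) ->
  trace col x (flatten [seq F j | j <- s]) = trace col x (F i).
Proof.
move=> us si Fj; elim: s us si => //= j s IHs /andP[js us].
rewrite inE trace_cat => /orP[/eqP ij|si]; last first.
  by rewrite IHs // Fj //; apply: contraNneq js => ->.
rewrite -ij in js *; rewrite (_ : trace _ _ (flatten _) = [::]) ?cats0 //.
elim: s js {us IHs} => //= l s IHs; rewrite inE negb_or => /andP[il js].
by rewrite trace_cat IHs // Fj // eq_sym.
Qed.

Lemma uniq_flatten_disjoint (I T : eqType) (F : I -> seq T) (s : seq I) :
  uniq s -> (forall i, uniq (F i)) ->
  (forall i j r, r \in F i -> r \in F j -> i = j) ->
  uniq (flatten [seq F i | i <- s]).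
Proof.
move=> us uF disj; elim: s us => //= i s IHs /andP[is_ us].
rewrite cat_uniq uF IHs // andbT; apply/hasPn => r /flatten_mapP[j js rj].
by apply/negP => ri; move: is_; rewrite (disj _ _ _ ri rj) js.
Qed.

(** The width is fixed before the position [a], so the families for the [c] answers can be placed
    side by side. *)
Lemma forces_static c m (h : history c) : forces m h ->
  exists w, forall a, exists s : seq rectangle,
    [/\ uniq s, all (in_cell a w) s &
        forall col : rectangle -> 'I_c, exists x,
          a <= x < a + w /\ won m (trace col x s ++ h)].
Proof.
elim=> {h} [h wh|h J _ IH].
  exists 1 => a; exists [::]; split=> // col; exists a; split=> //; lia.
have [w_ wP] := fin_all_exists IH; pose w := \max_i w_ i.
have w_le i : w_ i <= w by apply: leq_bigmax.
(* The extra unit makes [r0] too wide for any subcell, hence distinct from the later rectangles. *)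
exists (c * w).+1 => a.
have [F FP] := fin_all_exists (fun i => wP i (a + i * w)).
have cell i r : r \in F i -> in_cell (a + i * w) w r.
  have [_ /allP FiP _] := FP i => /FiP; rewrite /in_cell; move: (w_le i); lia.
have cell_lt (i : 'I_c) : i * w + w <= c * w.
  by rewrite -mulSnr leq_mul2r ltn_ord orbT.
have cell_inj (i j : 'I_c) x :
    a + i * w <= x < a + i * w + w -> a + j * w <= x < a + j * w + w -> i = j.
  by move=> xi xj; apply/val_inj => /=; case: (ltngtP i j) => // ij; nia.
pose r0 : rectangle := ((a, a + (c * w).+1), J).
exists (r0 :: flatten [seq F i | i <- enum 'I_c]); split=> /=.
- apply/andP; split.
    apply/negP => /flatten_mapP[i _ /cell]; rewrite /in_cell /=.
    by move: (cell_lt i); lia.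
  apply: uniq_flatten_disjoint => [|i|i j [[l r] J'] /cell ri /cell rj].
  + exact: enum_uniq.
  + by have [] := FP i.
  + by apply: (@cell_inj _ _ l); move: ri rj; rewrite /in_cell /=; lia.
- apply/andP; split; first by rewrite /in_cell /=; lia.
  apply/allP => r /flatten_mapP[i _ /cell]; rewrite /in_cell.
  by move: (cell_lt i); lia.
- move=> col; set i := col r0; have [_ _ /(_ col)[x [xi wx]]] := FP i.
  have xw : a + i * w <= x < a + i * w + w by move: (w_le i); lia.
  have xa : a <= x < a + (c * w).+1 by move: (cell_lt i); lia.
  exists x; split=> //; rewrite /trace /= /covers /= xa /= -/(trace col x _).
  rewrite (@trace_flatten _ _ _ _ F i) ?enum_uniq ?mem_enum //; last first.
    move=> j ji; apply: (@trace_outside _ _ _ (a + j * w) w).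
      by apply/allP => r /cell.
    by apply: contra ji => xj; rewrite (cell_inj j i x).
  (* [r0] heads the trace, but in the history its move is older than the continuation. *)
  apply: won_perm wx; rewrite -cat_rcons -cat_cons.
  by rewrite perm_cat2r perm_rcons.
Qed.

(** * Rectangles as points of R^4 *)

Local Open Scope ring_scope.
Local Open Scope fset_scope.

Import Order.TTheory GRing.Theory Num.Theory.

Definition vec4 {R : realType} (x y z w : R) : 'rV[R]_4 := \row_i [:: x; y; z; w]`_i.

(** [l <= x < r] becomes two lower bounds, [- x <= - l] and [x.+1 <= r]. *)
Definition point_of (R : realType) (r : rectangle) : 'rV[R]_4 :=
  vec4 (- r.1.1%:R) r.1.2%:R (- r.2.1%:R) r.2.2%:R.

Definition apex_of (R : realType) (x y : nat) : 'rV[R]_4 :=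
  vec4 (- x%:R) x.+1%:R (- y%:R) y.+1%:R.

Lemma point_of_inj (R : realType) : injective (point_of R).
Proof.
move=> [[l r] [p q]] [[l' r'] [p' q']] /rowP e.
have := (e 0, e 1, e 2%:R, e 3%:R); rewrite !mxE /= => -[[[]]].
move=> /oppr_inj /eqP; rewrite eqr_nat => /eqP ->.
move=> /eqP; rewrite eqr_nat => /eqP ->.
move=> /oppr_inj /eqP; rewrite eqr_nat => /eqP ->.
by move=> /eqP; rewrite eqr_nat => /eqP ->.
Qed.

Lemma point_of_hextant (R : realType) (r : rectangle) x y :
  (point_of R r \in hextant (apex_of R x y)) = covers r.1 x && covers r.2 y.
Proof.
rewrite inE; apply/forallP/idP => [e|].
  have := (e 0, e 1, e 2%:R, e 3%:R); rewrite !mxE /= => -[[[]]].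
  by rewrite !lerN2 !ler_nat /covers => -> -> -> ->.
rewrite /covers => /andP[/andP[xl xr] /andP[yl yr]].
by case=> [[|[|[|[|]]]] //= ilt]; rewrite !mxE /= ?lerN2 ler_nat.
Qed.

Theorem theorem13 (R : realType) (c m : nat) (c_gt0 : (0 < c)%N)
    (m_gt0 : (0 < m)%N) :
  exists S : {fset 'rV[R]_4},
    forall color : S -> 'I_c,
      exists a : 'rV[R]_4,
        #|[set p : S | val p \in hextant a]| = m /\
        exists k : 'I_c,
          forall p : S, val p \in hextant a -> color p = k.
Proof.
have [w /(_ 0%N)[s [us _ sP]]] := forces_static _ _ _ (forces_nil c m m_gt0).
exists [fset point_of R r | r in s] => color.
have inS r : r \in s -> point_of R r \in [fset point_of R r | r in s].
  by move=> rs; apply/imfsetP; exists r.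
(* Rectangles outside [s] get colour 0 as a filler. *)
pose col r := oapp color (Ordinal c_gt0) (insub (point_of R r)).
have [x [_]] := sP col; rewrite cats0 => -[y [k /andP[/eqP cnt /allP mono]]].
exists (apex_of R x y); split; last first.
  exists k => p; have /imfsetP[r /= rs pr] := valP p.
  rewrite pr point_of_hextant => /andP[rx ry].
  have /mono : (r.2, col r) \in trace col x s.
    by apply/mapP; exists r; rewrite ?mem_filter ?rx.
  by rewrite /= ry /= /col -pr valK => /eqP.
(* [point_of] matches the rectangles of [s] that cover [(x, y)] with the points in the hextant. *)
rewrite -{}cnt /trace count_map count_filter -size_filter cardE.
rewrite -(size_map val) -[RHS](size_map (point_of R)).
apply/perm_size/uniq_perm.
- by rewrite map_inj_uniq ?enum_uniq //; apply: val_inj.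
- by rewrite map_inj_uniq ?filter_uniq //; apply: point_of_inj.
move=> p; apply/mapP/mapP => [[q]|[r]].
  rewrite mem_enum in_set => qa ->; have /imfsetP[r /= rs qr] := valP q.
  exists r => //; rewrite mem_filter rs andbT /=.
  by move: qa; rewrite (qr : val q = _) point_of_hextant andbC.
rewrite mem_filter /= => /andP[/andP[ry rx] rs] ->.
exists [` inS r rs] => //.
by rewrite mem_enum in_set point_of_hextant rx ry.
Qed.
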